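(* Let $F$ be a known, strictly monotone distribution function with support on $(-\infty,+\infty)$. Suppose $Y\sim N(\mu,\sigma^2)$ and $P(R=1\mid Y=y)=F(\alpha+\beta y)$, with unknown parameters $\mu\in\mathbb{R}$, $\sigma^2>0$, $\alpha,\beta\in\mathbb{R}$. Then: (a) $\sigma^2$ and $|\beta|$ are identifiable; (b) $\mu,\sigma^2,\alpha,\beta$ are identifiable if the sign of $\beta$ is known; (c) $\mu,\sigma^2,\alpha,\beta$ are identifiable if, for every $\delta>0$, $\lim_{z\to-\infty}F(z)/e^{\delta z}$ equals $0$ or $+\infty$.
   Context: $Y$ is an outcome variable and $R\in\{0,1\}$ is its missingness indicator ($R=1$ if $Y$ is observed). The observed distribution is $P(y,R=1)$, which here is the function $y\mapsto \frac1\sigma\phi\left(\frac{y-\mu}{\sigma}\right)F(\alpha+\beta y)$, where $\phi$ is the standard normal density. A function of the parameters is identifiable if any two parameter vectors in the parameter space that yield the same observed distribution give the same value of that function. ''The sign of $\beta$ is known'' means that the parameter space is restricted to parameter vectors whose $\beta$ has one prescribed sign, so that only parameter vectors with the same sign of $\beta$ are compared. *)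

(* Defs.v *)
From HB Require Import structures.
From mathcomp Require Export all_boot all_order all_algebra.
From mathcomp Require Export all_classical all_reals all_analysis.
Export Order.TTheory GRing.Theory Num.Theory.
Export numFieldNormedType.Exports.

Set Implicit Arguments.
Unset Strict Implicit.
Unset Printing Implicit Defensive.

Local Open Scope classical_set_scope.
Local Open Scope ring_scope.

Record parameter (R : realType) := MkParameter {
  mu : R;
  sigma2 : R;
  alpha : R;
  beta : R }.

Definition parameter_space (R : realType) : set (parameter R) :=
  [set theta | 0 < sigma2 theta].
Arguments parameter_space R : clear implicits.

(* Topological support of the probability measure dF. *)
Definition distribution_support (R : realType)
    (F : cumulativeBounded (0 : R) (1 : R)) : set R :=
  [set x | forall U : set R, open U -> U x ->
           (0 < lebesgue_stieltjes_measure F U)%E].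

(* P(y, R = 1) = P(R = 1 | Y = y) * (density of Y at y) for Y ~ N(mu, sigma2)
   and P(R = 1 | Y = y) = F (alpha + beta * y). *)
Definition observed_distribution (R : realType) (F : R -> R)
    (theta : parameter R) (y : R) : R :=
  let sigma := Num.sqrt (sigma2 theta) in
  sigma^-1 * normal_pdf 0 1 ((y - mu theta) / sigma)
    * F (alpha theta + beta theta * y).

Definition identifiable (R : realType) (F : R -> R)
    (Theta : set (parameter R)) (T : Type) (g : parameter R -> T) : Prop :=
  forall theta theta' : parameter R, Theta theta -> Theta theta' ->
    observed_distribution F theta =1 observed_distribution F theta' ->
    g theta = g theta'.

(* The value s is one of -1, 0, 1; for any other s the set is empty. *)
Definition known_sign (R : realType) (s : R) : set (parameter R) :=
  parameter_space R `&` [set theta | Num.sg (beta theta) = s].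

(* Main.v *)
(* Write theta = (mu, sigma2, a, b). If theta and theta' have the same observed
   distribution, then ln (F (a + b y)) - ln (F (a' + b' y)) is a polynomial of
   degree at most 2 in y, constant exactly when mu = mu' and sigma2 = sigma2'.
   If b and b' have weakly the same sign, it converges as y tends to +oo or to
   -oo, hence it is constant, and theta = theta' since F is injective.
   If b' < 0 < b, its sign changes from - to + where the two affine functions
   cross, so it is c1 y + c0 with c1 > 0, and sigma2 = sigma2'. At each of the
   two ends one of the two logarithms tends to ln 1 = 0, so the other one gives
   the left tail of F: ln (F z) - delta z converges as z tends to -oo, both for
   delta = c1 / b and for delta = c1 / - b'. Hence b' = - b, and this tail is
   what the condition in (c) excludes. *)

From mathcomp Require Import ring lra.
Require Import Defs.

Set Implicit Arguments.
Unset Strict Implicit.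
Unset Printing Implicit Defensive.

Local Open Scope classical_set_scope.
Local Open Scope ring_scope.

(** * Affine and quadratic functions near infinity *)

Lemma cvg_affine_pinfty (R : realType) (a k : R) : 0 < k ->
  a + k * y @[y --> +oo_R] --> +oo_R.
Proof.
move=> k0; apply: (@cvg_comp _ _ _ (fun y => k * y) (fun y => a + y) _ +oo_R).
  by apply: gt0_cvgMry => //; exact: cvg_id.
exact: cvg_addrl.
Qed.

(** A forward difference of a convergent function tends to 0. The second difference is the constant
    [c2 *+ 2]; once [c2] vanishes, the first one is the constant [c1]. *)
Lemma cvg_quadratic (R : realType) (c2 c1 c0 l : R) :
  c2 * y ^+ 2 + c1 * y + c0 @[y --> +oo_R] --> l -> c2 = 0 /\ c1 = 0.
Proof.
pose diff (f : R -> R) y := f (y + 1) - f y.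
have cvg_diff (f : R -> R) (m : R) : f y @[y --> +oo_R] --> m ->
    diff f y @[y --> +oo_R] --> (0 : R).
  move=> fm; rewrite -(subrr m); apply: cvgB => //.
  by apply: cvg_comp fm; exact: cvg_addrr.
have cst_lim0 (c : R) : cst c y @[y --> +oo_R] --> (0 : R) -> c = 0.
  by move=> c_0; apply: cvg_unique (cvg_cst _) c_0.
move=> /cvg_diff Ql.
have c20 : c2 = 0.
  suff : c2 *+ 2 = 0 by lra.
  apply: cst_lim0; have := cvg_diff _ _ Ql; apply: cvg_trans.
  by apply: near_eq_cvg; near=> y; rewrite /diff /=; ring.
split=> //; apply: cst_lim0; apply: cvg_trans Ql.
by apply: near_eq_cvg; near=> y; rewrite /diff /= c20; ring.
Unshelve. all: by end_near. Qed.

Lemma quadratic_eventually_ge0 (R : realType) (m c2 c1 c0 : R) :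
  (forall y, m < y -> 0 <= c2 * y ^+ 2 + c1 * y + c0) -> 0 <= c2.
Proof.
move=> Q_ge0; rewrite leNgt; apply/negP => c2_lt0.
pose q := (`|c1| + `|c0|) / - c2.
have q_ge0 : 0 <= q by rewrite divr_ge0 ?addr_ge0 // oppr_ge0 ltW.
have qE : - c2 * q = `|c1| + `|c0| by rewrite mulrC divfK // oppr_eq0 lt_eqF.
(* This point lies beyond [m] and is at least 1, and the summand [q] makes the quadratic at most
   [c2 * y], which is negative. *)
pose y := 1 + `|m| + q.
have [m_ge0 m_le c1_le c0_le c0_ge0] :
    [/\ 0 <= `|m|, m <= `|m|, c1 <= `|c1|, c0 <= `|c0| & 0 <= `|c0|].
  by split; rewrite ?ler_norm ?normr_ge0.
have y_ge1 : 1 <= y by rewrite /y; lra.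
have : 0 <= c2 * y ^+ 2 + c1 * y + c0 by apply: Q_ge0; rewrite /y; lra.
have c2y : - c2 * y >= - c2 + `|c1| + `|c0| by rewrite /y; nra.
nra.
Qed.

(** * Positivity, injectivity and right tail of [F] *)

Section strictly_monotone_distribution.
Variables (R : realType) (F : cumulativeBounded (0 : R) (1 : R)).
Hypothesis F_mono : {homo F : x y / x < y}.

Lemma distribution_gt0 x : 0 < F x.
Proof.
suff F_ge0 : 0 <= F (x - 1) by apply: le_lt_trans F_ge0 (F_mono _); lra.
apply: (cvgr_to_le (cumulativeNy F)); near=> y.
by apply: cumulative_is_nondecreasing; near: y; exact: nbhs_ninfty_le.
Unshelve. all: by end_near. Qed.

Lemma distribution_inj : injective F.
Proof.
by move=> x y Fxy; case: (ltgtP x y) => // /F_mono; rewrite Fxy ltxx.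
Qed.

Lemma is_cvg_ln_distribution (a k : R) : 0 <= k ->
  exists l : R, ln (F (a + k * y)) @[y --> +oo_R] --> l.
Proof.
rewrite le_eqVlt => /predU1P[<-|k_gt0].
  exists (ln (F a)); under eq_fun do rewrite mul0r addr0; exact: cvg_cst.
exists (ln 1); apply: continuous_cvg; first exact: continuous_ln.
by apply: cvg_comp (cumulativey F); exact: cvg_affine_pinfty.
Qed.

(** * Logarithms of the observed distribution *)

Definition log_response (theta : parameter R) (y : R) : R :=
  ln (F (alpha theta + beta theta * y)).

Lemma ln_observed_distribution (theta : parameter R) :
  parameter_space R theta -> exists c : R, forall y,
  ln (observed_distribution F theta y) =
  c - (y - mu theta) ^+ 2 / (2 * sigma2 theta) + log_response theta y.
Proof.
rewrite /parameter_space /= => s_gt0.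
have sigma_gt0 : 0 < Num.sqrt (sigma2 theta) by rewrite sqrtr_gt0.
have peak_gt0 : 0 < normal_peak (1 : R) := normal_peak_gt0 (oner_neq0 R).
exists (ln (Num.sqrt (sigma2 theta))^-1 + ln (normal_peak (1 : R))) => y.
rewrite /observed_distribution normal_pdfE ?oner_neq0 // /normal_fun subr0.
have sigmaV_gt0 : 0 < (Num.sqrt (sigma2 theta))^-1 by rewrite invr_gt0.
rewrite lnM ?posrE ?distribution_gt0 //; last first.
  by rewrite mulr_gt0 // mulr_gt0 // expR_gt0.
rewrite lnM ?posrE //; last by rewrite mulr_gt0 // expR_gt0.
rewrite lnM ?posrE ?expR_gt0 // expRK.
rewrite addrA; congr (_ + _ + _).
rewrite exprMn exprVn sqr_sqrtr ?ltW // expr1n.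
by field; rewrite gt_eqF.
Qed.

Lemma log_response_diff (theta theta' : parameter R) :
  parameter_space R theta -> parameter_space R theta' ->
  observed_distribution F theta =1 observed_distribution F theta' ->
  exists c0 : R, forall y, log_response theta y - log_response theta' y =
    ((sigma2 theta)^-1 - (sigma2 theta')^-1) / 2 * y ^+ 2
    + (mu theta' / sigma2 theta' - mu theta / sigma2 theta) * y + c0.
Proof.
move=> th_gt0 th'_gt0 obs.
have [c Ec] := ln_observed_distribution th_gt0.
have [c' Ec'] := ln_observed_distribution th'_gt0.
exists (c' - c + mu theta ^+ 2 / (2 * sigma2 theta)
  - mu theta' ^+ 2 / (2 * sigma2 theta')) => y.
have -> : log_response theta y - log_response theta' y =
    c' - c + (y - mu theta) ^+ 2 / (2 * sigma2 theta)
    - (y - mu theta') ^+ 2 / (2 * sigma2 theta').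
  by have := Ec y; rewrite obs Ec'; lra.
by rewrite /parameter_space /= in th_gt0 th'_gt0; field; rewrite !gt_eqF.
Qed.

(** The common normal density is positive and cancels; injectivity of [F] then equates the two
    affine functions, which are compared at 0 and 1. *)
Lemma eq_parameter (theta theta' : parameter R) :
  parameter_space R theta -> parameter_space R theta' ->
  observed_distribution F theta =1 observed_distribution F theta' ->
  sigma2 theta = sigma2 theta' -> mu theta = mu theta' -> theta = theta'.
Proof.
rewrite /parameter_space /= => th_gt0 _ obs.
case: theta theta' => [m s a b] [m' s' a' b'] /= in th_gt0 obs *.
move=> s_eq m_eq; subst m' s'.
have sigma_gt0 : 0 < Num.sqrt s by rewrite sqrtr_gt0.
have affine_eq y : a + b * y = a' + b' * y.
  move: (obs y); rewrite /observed_distribution /=.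
  move=> /mulfI => cancel_density; apply: distribution_inj.
  apply: cancel_density; rewrite normal_pdfE ?oner_neq0 // gt_eqF //.
  rewrite mulr_gt0 ?invr_gt0 //.
  by apply: mulr_gt0; [exact: normal_peak_gt0 (oner_neq0 _)|exact: expR_gt0].
have a_eq : a = a' by have := affine_eq 0; rewrite !mulr0 !addr0.
by have := affine_eq 1; rewrite a_eq !mulr1 => /addrI ->.
Qed.

(** * Slopes of weakly the same sign *)

Lemma weakly_same_sign_eq (theta theta' : parameter R) :
  parameter_space R theta -> parameter_space R theta' ->
  observed_distribution F theta =1 observed_distribution F theta' ->
  0 <= beta theta * beta theta' -> theta = theta'.
Proof.
move=> th_gt0 th'_gt0 obs b_ge0.
(* The direction [e] is 1 or -1, chosen so that neither argument of [F] decreases along [e * y]; a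
   zero slope follows the sign of the other one. *)
have [e [e2 be_ge0 be'_ge0]] : exists e : R,
    [/\ e * e = 1, 0 <= beta theta * e & 0 <= beta theta' * e].
  have [b_pos|b_neg|b0] := ltgtP 0 (beta theta).
  - by exists 1; rewrite !mulr1 ltW // -(pmulr_rge0 _ b_pos).
  - by exists (-1); split; [lra|lra|nra].
  - have [?|?] := leP 0 (beta theta').
      by exists 1; split; rewrite -?b0; lra.
    by exists (-1); split; rewrite -?b0; lra.
have [c0 Q] := log_response_diff th_gt0 th'_gt0 obs.
have [l lim_l] := is_cvg_ln_distribution (alpha theta) be_ge0.
have [l' lim_l'] := is_cvg_ln_distribution (alpha theta') be'_ge0.
have [] : ((sigma2 theta)^-1 - (sigma2 theta')^-1) / 2 = 0 /\
    (mu theta' / sigma2 theta' - mu theta / sigma2 theta) * e = 0.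
  apply: (@cvg_quadratic _ _ _ c0 (l - l')).
  apply: cvg_trans (cvgB lim_l lim_l'); apply: near_eq_cvg; near=> y => /=.
  have := Q (e * y); rewrite fctE /log_response !(mulrA _ e y) => ->.
  by rewrite exprMn expr2 e2 mul1r.
have e_neq0 : e != 0.
  by apply: contra_eq_neq e2 => ->; rewrite mul0r eq_sym oner_neq0.
move=> /eqP; rewrite mulf_eq0 invr_eq0 pnatr_eq0 orbF subr_eq0.
move=> /eqP/invr_inj s_eq.
move=> /eqP; rewrite mulf_eq0 (negPf e_neq0) orbF subr_eq0 -s_eq => /eqP.
have s_neq0 : (sigma2 theta)^-1 != 0 by rewrite invr_eq0 gt_eqF.
by move=> /(mulIf s_neq0) m_eq; apply: eq_parameter.
Unshelve. all: by end_near. Qed.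

(** * Slopes of opposite signs and the left tail of [F] *)

Lemma opposite_sign_log_response (theta theta' : parameter R) :
  parameter_space R theta -> parameter_space R theta' ->
  observed_distribution F theta =1 observed_distribution F theta' ->
  beta theta' < 0 < beta theta ->
  sigma2 theta = sigma2 theta' /\
  exists c1 c0 : R, 0 < c1 /\
    forall y, log_response theta y - log_response theta' y = c1 * y + c0.
Proof.
move=> th_gt0 th'_gt0 obs /andP[b'_lt0 b_gt0].
have [c0] := log_response_diff th_gt0 th'_gt0 obs.
set c2 := _ / 2; set c1 := _ - _ / _ => Q.
(* The abscissa where the two affine functions cross. *)
pose m := (alpha theta' - alpha theta) / (beta theta - beta theta').
have mE : (beta theta - beta theta') * m = alpha theta' - alpha theta.
  by rewrite mulrC divfK // gt_eqF //; lra.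
have Q_gt0 y : m < y -> 0 < c2 * y ^+ 2 + c1 * y + c0.
  move=> my; rewrite -Q subr_gt0 ltr_ln ?posrE; try exact: distribution_gt0.
  by apply: F_mono; nra.
have Q_lt0 y : y < m -> c2 * y ^+ 2 + c1 * y + c0 < 0.
  move=> my; rewrite -Q subr_lt0 ltr_ln ?posrE; try exact: distribution_gt0.
  by apply: F_mono; nra.
have c2_ge0 : 0 <= c2.
  by apply: (@quadratic_eventually_ge0 _ m _ c1 c0) => y /Q_gt0/ltW.
(* The left end is reduced to the right end by negating the quadratic and reflecting [y]. *)
have c2_le0 : 0 <= - c2.
  apply: (@quadratic_eventually_ge0 _ (- m) _ c1 (- c0)) => y my.
  by have := Q_lt0 (- y); rewrite sqrrN; lra.
have c20 : c2 = 0 by lra.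
split.
  move: c20 => /eqP; rewrite mulf_eq0 invr_eq0 pnatr_eq0 orbF subr_eq0.
  by move=> /eqP/invr_inj.
exists c1, c0; split; last by move=> y; rewrite Q c20 mul0r add0r.
(* The values at [m + 1] and [m - 1] differ by [2 * c1]. *)
have := Q_gt0 (m + 1); have := Q_lt0 (m - 1); rewrite c20 !mul0r !add0r; lra.
Qed.

(** Put y = -(z + a) / b: the argument for [theta] becomes -z, while the one for [theta'] grows to
    infinity, so its logarithm tends to [ln 1]. Only the sign of the product of slopes enters, so
    the two parameters may be exchanged. *)
Lemma exponential_left_tail (theta theta' : parameter R) (c1 c0 : R) :
  beta theta * beta theta' < 0 ->
  (forall y, log_response theta y - log_response theta' y = c1 * y + c0) ->
  exists C : R, ln (F (- z)) + c1 / beta theta * z @[z --> +oo_R] --> C.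
Proof.
move=> bb' Q.
have b_neq0 : beta theta != 0.
  by apply: contraTneq bb' => ->; rewrite mul0r ltxx.
set b := beta theta in bb' b_neq0 *; set a := alpha theta.
(* The second summand is the part of c1 y + c0 that is free of z after the substitution. *)
exists (ln 1 + (c0 - c1 / b * a)).
pose a' := alpha theta' - beta theta' * a / b; pose k := - beta theta' / b.
have k_gt0 : 0 < k.
  rewrite -(pmulr_lgt0 _ (_ : 0 < b ^+ 2)) ?exprn_even_gt0 //=.
  by rewrite /k expr2 mulrA divfK //; lra.
have lim1 : ln (F (a' + k * z)) @[z --> +oo_R] --> (ln 1 : R).
  apply: continuous_cvg; first exact: continuous_ln.
  by apply: cvg_comp (cumulativey F); exact: cvg_affine_pinfty.
apply: cvg_trans (cvgD lim1 (cvg_cst (c0 - c1 / b * a))).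
apply: near_eq_cvg; near=> z; rewrite fctE /=.
have := Q (- (z + a) / b); rewrite /log_response -/a -/b.
have -> : a + b * (- (z + a) / b) = - z by field.
have -> : alpha theta' + beta theta' * (- (z + a) / b) = a' + k * z.
  by rewrite /a' /k; field.
move=> E.
have -> : ln (F (- z)) =
    ln (F (a' + k * z)) + (c1 * (- (z + a) / b) + c0) by lra.
by rewrite /cst; field.
Unshelve. all: by end_near. Qed.

Lemma opposite_sign_eq (theta theta' : parameter R) :
  parameter_space R theta -> parameter_space R theta' ->
  observed_distribution F theta =1 observed_distribution F theta' ->
  beta theta' < 0 < beta theta ->
  [/\ sigma2 theta = sigma2 theta', `|beta theta| = `|beta theta'| &
      exists2 delta : R, 0 < delta & exists C : R,
        ln (F (- z)) + delta * z @[z --> +oo_R] --> C].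
Proof.
move=> th_gt0 th'_gt0 obs /[dup] bb /andP[b'_lt0 b_gt0].
have [s_eq [c1 [c0 [c1_gt0 Q]]]] :=
  opposite_sign_log_response th_gt0 th'_gt0 obs bb.
have Q' y : log_response theta' y - log_response theta y = - c1 * y + - c0.
  by have := Q y; lra.
have [|C lim_C] := exponential_left_tail _ Q; first by nra.
have [|C' lim_C'] := exponential_left_tail _ Q'; first by nra.
split=> //; last by exists (c1 / beta theta); [rewrite divr_gt0|exists C].
(* The difference of the two convergent expressions is linear in z, so the two tail rates agree. *)
have [_] : (0 : R) = 0 /\ c1 / beta theta - - c1 / beta theta' = 0.
  apply: (@cvg_quadratic _ _ _ 0 (C - C')).
  apply: cvg_trans (cvgB lim_C lim_C').
  apply: near_eq_cvg; near=> z; rewrite !fctE.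
  by ring.
rewrite gtr0_norm // ltr0_norm // => E.
have b_neq0 : beta theta != 0 by rewrite gt_eqF.
have b'_neq0 : beta theta' != 0 by rewrite lt_eqF.
have : c1 * (beta theta + beta theta') = 0.
  transitivity ((c1 / beta theta - - c1 / beta theta') *
      (beta theta * beta theta')).
    by field; rewrite b_neq0 b'_neq0.
  by rewrite E mul0r.
by move=> /eqP; rewrite mulf_eq0 gt_eqF //= => /eqP; lra.
Unshelve. all: by end_near. Qed.

(** Exponentiating, the ratio tends to [expR C], which is neither 0 nor infinite. *)
Lemma no_exponential_left_tail (delta C : R) :
  ln (F (- z)) + delta * z @[z --> +oo_R] --> C ->
  ~ ((F z / expR (delta * z) @[z --> -oo_R] --> (0 : R)) \/
     (F z / expR (delta * z) @[z --> -oo_R] --> +oo_R)).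
Proof.
move=> lim_C.
have ratio_lim : F (- z) / expR (delta * - z) @[z --> +oo_R] --> expR C.
  apply: cvg_trans (continuous_cvg _ (@continuous_expR R C) lim_C).
  apply: near_eq_cvg; near=> z => /=.
  by rewrite expRD lnK ?posrE ?distribution_gt0 // mulrN expRN invrK.
case=> /cvgNy_compNP ratio_lim'.
  by have := expR_gt0 C; rewrite (cvg_unique _ ratio_lim ratio_lim') ?ltxx.
suff : expR C + 1 <= expR C by rewrite gerDl ler10.
exact: cvgr_to_ge ratio_lim (cvgry_ge ratio_lim' (expR C + 1)).
Unshelve. all: by end_near. Qed.

(** All three claims follow from this dichotomy: the second case keeps [sigma2] and the absolute
    slope, contradicts a common sign, and forces an exponential left tail. The two orders of the
    signs are exchanged by symmetry of [obs]. *)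
Lemma observed_distribution_cases (theta theta' : parameter R) :
  parameter_space R theta -> parameter_space R theta' ->
  observed_distribution F theta =1 observed_distribution F theta' ->
  theta = theta' \/
  [/\ beta theta * beta theta' < 0, sigma2 theta = sigma2 theta',
      `|beta theta| = `|beta theta'| &
      exists2 delta : R, 0 < delta & exists C : R,
        ln (F (- z)) + delta * z @[z --> +oo_R] --> C].
Proof.
move=> th_gt0 th'_gt0 obs.
have [b_ge0|b_lt0] := leP 0 (beta theta * beta theta').
  by left; exact: weakly_same_sign_eq.
right; have obs' := fsym obs.
have [b'_lt0|b'_ge0] := ltP (beta theta') 0.
  have b_gt0 : 0 < beta theta by nra.
  by have [|? ? ?] := opposite_sign_eq th_gt0 th'_gt0 obs; first by apply/andP.
have b'_gt0 : 0 < beta theta'.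
  rewrite lt_neqAle b'_ge0 andbT; apply: contraTneq b_lt0 => <-.
  by rewrite mulr0 ltxx.
have b_neg : beta theta < 0 by nra.
by have [|-> ->] := opposite_sign_eq th'_gt0 th_gt0 obs'; first by apply/andP.
Qed.

End strictly_monotone_distribution.

Theorem theorem1 (R : realType) (F : cumulativeBounded (0 : R) (1 : R))
    (F_mono : {homo F : x y / x < y})
    (F_supp : distribution_support F = setT) :
  [/\ (* (a) *)
      identifiable F (parameter_space R) (@sigma2 R) /\
      identifiable F (parameter_space R) (fun theta => `|beta theta|),
      (* (b) *)
      forall s : R,
        [/\ identifiable F (known_sign s) (@mu R),
            identifiable F (known_sign s) (@sigma2 R),
            identifiable F (known_sign s) (@alpha R) &
            identifiable F (known_sign s) (@beta R)]
    & (* (c) *)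
      (forall delta : R, 0 < delta ->
         (F z / expR (delta * z) @[z --> -oo_R] --> (0 : R)) \/
         (F z / expR (delta * z) @[z --> -oo_R] --> +oo_R)) ->
        [/\ identifiable F (parameter_space R) (@mu R),
            identifiable F (parameter_space R) (@sigma2 R),
            identifiable F (parameter_space R) (@alpha R) &
            identifiable F (parameter_space R) (@beta R)]].
Proof.
(* Taking [id] as the function, identifiability of the whole vector yields that of each
   coordinate. *)
have identifiable_id Theta (g : parameter R -> R) :
    identifiable F Theta id -> identifiable F Theta g.
  by move=> id_ident th th' Tth Tth' /(id_ident _ _ Tth Tth')->.
split.
- by split=> th th' Tth Tth' obs;
    have [->|[]] := observed_distribution_cases F_mono Tth Tth' obs.
- move=> s; suff : identifiable F (known_sign s) id.
    by split; exact: identifiable_id.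
  move=> th th' [Tth sg] [Tth' sg'] obs.
  have [//|[+ _ _ _]] := observed_distribution_cases F_mono Tth Tth' obs.
  (* The product of the slopes has sign [s ^+ 2], which is never negative, whatever [s] is. *)
  by rewrite -sgr_lt0 sgrM sg sg' -expr2 ltNge sqr_ge0.
- move=> tail; suff : identifiable F (parameter_space R) id.
    by split; exact: identifiable_id.
  move=> th th' Tth Tth' obs.
  have [//|[_ _ _ [delta delta_gt0 [C lim_C]]]] :=
    observed_distribution_cases F_mono Tth Tth' obs.
  by have := no_exponential_left_tail F_mono lim_C (tail _ delta_gt0).
Qed.
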